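(* Let $N\geqslant 1$ and $1\leqslant h_1<h_2<\cdots<h_k$ be integers, and suppose that the set of positive integers $n$ with $t(n)=t(N)$ and $t(n+h_i)=t(N+h_i)$ for all $1\le i\le k$ is infinite. Let $n_1<n_2<\cdots$ be the increasing enumeration of all such $n$ with $n\geqslant N$ (so $n_1=N$). Then $$\limsup_{l\to+\infty}\,(n_{l+1}-n_l-h_k)=+\infty.$$
   Context: Every integer $n\ge 1$ is assigned a finite rooted planar tree $t(n)$: $t(1)$ is the single-vertex tree; if $n=p_1^{a_1}\cdots p_s^{a_s}$ with primes $p_1<\dots<p_s$ and $a_i\ge1$, then $t(n)$ consists of a root with $s$ edges to children, ordered left to right, the $i$-th edge leading to a copy of $t(a_i)$ rooted at that child. *)

(* Defs.v *)
From mathcomp Require Import all_boot all_order all_algebra.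
From mathcomp Require Import all_classical all_reals all_analysis.

Set Implicit Arguments.
Unset Strict Implicit.
Unset Printing Implicit Defensive.

(* The children of a vertex are listed from left to right, so Leibniz equality
   is equality of planar rooted trees. *)
Inductive ptree : Type := Node of seq ptree.

Fixpoint factor_tree_rec (fuel n : nat) : ptree :=
  if fuel is fuel'.+1 then
    Node [seq factor_tree_rec fuel' f.2 | f <- prime_decomp n]
  else Node [::].

(* t(n). The fuel n suffices because an exponent in the factorization of n is
   smaller than n (see factor_treeE); factor_tree 0 is a junk value. *)
Definition factor_tree (n : nat) : ptree := factor_tree_rec n n.

Lemma prime_decomp_exp_lt (n p a : nat) : (p, a) \in prime_decomp n -> a < n.
Proof.
case: n => [|n] // /mem_prime_decomp[p_pr _ dvd_n].
exact: leq_trans (ltn_expl a (prime_gt1 p_pr)) (dvdn_leq _ dvd_n).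
Qed.

Lemma factor_tree_rec_fuel (k m n : nat) :
  n <= k -> n <= m -> factor_tree_rec k n = factor_tree_rec m n.
Proof.
elim: k m n => [|k IHk] [|m] [|n] //= le_nk le_nm.
congr Node; apply/eq_in_map => -[p a] /prime_decomp_exp_lt lt_an /=.
by apply: IHk; rewrite -ltnS; [apply: leq_trans lt_an le_nk
                              | apply: leq_trans lt_an le_nm].
Qed.

Lemma factor_tree1 : factor_tree 1 = Node [::].
Proof. by []. Qed.

Lemma factor_treeE (n : nat) :
  factor_tree n = Node [seq factor_tree f.2 | f <- prime_decomp n].
Proof.
case: n => [|n] //=; rewrite {1}/factor_tree /=.
congr Node; apply/eq_in_map => -[p a] /prime_decomp_exp_lt lt_an /=.
exact: factor_tree_rec_fuel.
Qed.

Local Open Scope classical_set_scope.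

(* The offsets h_1 < ... < h_k are h ord0 < ... < h ord_max, so that h is
   indexed by a nonempty ordinal type. *)
Definition same_trees (N k : nat) (h : 'I_k.+1 -> nat) : set nat :=
  [set n | [/\ 0 < n, factor_tree n = factor_tree N &
               forall i, factor_tree (n + h i) = factor_tree (N + h i)]].

(* Main.v *)
Require Import Defs.
From mathcomp Require Import all_boot all_order all_algebra.
From mathcomp Require Import all_classical all_reals all_analysis.

(** The tree t(n) determines the number of distinct prime factors of n, so it
    suffices to find arbitrarily long and arbitrarily late runs of consecutive
    integers having more prime factors than N: such a run contains no term of
    the sequence, and the consecutive terms around it are far apart. If
    x, ..., x + L - 1 each have at least s prime factors and P is their product,
    then x + P^2 + i is the product of x + i and of 1 + P * (P / (x + i)), which
    is coprime to x + i and exceeds 1, so the run starting at x + P^2 has at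
    least s + 1 prime factors in each entry. *)

Lemma size_primes_mul_coprime (m n : nat) :
  0 < m -> 1 < n -> coprime m n -> size (primes m) < size (primes (m * n)).
Proof.
move=> m_gt0 n_gt1 co_mn; have n_gt0 := ltnW n_gt1.
have pn : pdiv n \in primes n.
  by rewrite mem_primes pdiv_prime // n_gt0 pdiv_dvd.
apply: (@uniq_leq_size _ (pdiv n :: primes m)) => [|p] /=.
  rewrite primes_uniq andbT.
  by move: co_mn; rewrite coprime_has_primes // => /hasPn; apply.
by rewrite inE primesM // => /orP[/eqP-> | ->] //; rewrite pn orbT.
Qed.

Lemma run_with_many_primes (s L B : nat) :
  exists2 x, B <= x & forall i, i < L -> s <= size (primes (x + i)).
Proof.
elim: s B => [|s IHs] B; first by exists B.
(* The bound [B.+1] rather than [B] keeps [x] positive even when [B] is 0. *)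
have [x ltBx sx] := IHs B.+1.
have x_gt0 i : 0 < x + i by rewrite addn_gt0 (leq_ltn_trans _ ltBx).
set P := \prod_(i < L) (x + i).
have P_gt0 : 0 < P by apply: prodn_gt0 => i; apply: x_gt0.
exists (x + P * P) => [|i ltiL].
  exact: leq_trans (ltnW ltBx) (leq_addr _ _).
have /dvdnP[q defP] : x + i %| P.
  by rewrite /P (bigD1 (Ordinal ltiL)) //= dvdn_mulr.
have q_gt0 : 0 < q by move: P_gt0; rewrite defP muln_gt0 => /andP[].
have -> : x + P * P + i = (x + i) * (P * q + 1).
  by rewrite mulnDr muln1 mulnCA [(x + i) * q]mulnC -defP addnAC addnC.
apply: leq_ltn_trans (sx i ltiL) _; apply: size_primes_mul_coprime => //.
  by rewrite addn1 ltnS muln_gt0 P_gt0.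
by rewrite defP mulnAC /coprime gcdnMDl gcdn1.
Qed.

Lemma size_primes_factor_tree (m n : nat) :
  factor_tree m = factor_tree n -> size (primes m) = size (primes n).
Proof.
by rewrite !factor_treeE => -[/(congr1 size)]; rewrite /primes !size_map.
Qed.

(** The last term at most [x] and its successor enclose the whole missed run. *)
Lemma large_gap_around_run (u : nat -> nat) (x L l0 : nat) :
    (forall i j, i < j -> u i < u j) -> u l0 <= x ->
    (forall l i, i < L -> u l <> x.+1 + i) ->
  exists2 l, l0 <= l & L < u l.+1 - u l.
Proof.
move=> u_incr u_l0 miss.
(* This bounds by [x] the indices [l] with [u l <= x], so there is a largest one. *)
have le_u l : l <= u l.
  by elim: l => // l IHl; apply: leq_ltn_trans IHl (u_incr _ _ _).
have [l ul max_l] := @ex_maxnP (fun l => u l <= x) x (ex_intro _ l0 u_l0)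
  (fun l => leq_trans (le_u l)).
exists l; first exact: max_l.
have lt_xu : x < u l.+1.
  by rewrite ltnNge; apply/negP => /max_l; rewrite ltnn.
suff lt_xLu : x + L < u l.+1.
  by rewrite ltn_subRL (leq_ltn_trans _ lt_xLu) // leq_add2r.
(* Otherwise [u l.+1] would itself lie in the run. *)
rewrite ltnNge; apply/negP => le_ux; apply: (miss l.+1 (u l.+1 - x.+1)).
  by rewrite -ltnS -subSn // subSS ltn_subLR ?addnS ?ltnS // ltnW.
by rewrite subnKC.
Qed.

Import Order.TTheory GRing.Theory Num.Theory.

Local Open Scope classical_set_scope.
Local Open Scope ring_scope.

(** Every tail supremum exceeds all reals, so the limit is that of a constant sequence. *)
Lemma limn_esup_pinfty (R : realType) (u : nat -> \bar R) :
    (forall (A : R) (n : nat), exists2 l, (n <= l)%N & (A%:E <= u l)%E) ->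
  limn_esup u = +oo%E.
Proof.
move=> u_large; rewrite limn_esup_lim.
suff -> : esups u = cst +oo%E by exact: lim_cst.
apply/funext => n; apply/eqyP => A _.
have [l nl Al] := u_large A n.
by apply: le_trans Al _; apply: ereal_sup_ubound; exists l.
Qed.

Theorem theorem3 (R : realType) (N k : nat) (h : 'I_k.+1 -> nat)
    (N_ge1 : (1 <= N)%N)
    (h_ge1 : (1 <= h ord0)%N)
    (h_incr : forall i j : 'I_k.+1, (i < j)%N -> (h i < h j)%N)
    (infinite_n : infinite_set (same_trees N h))
    (n_ : nat -> nat)
    (n_incr : forall i j : nat, (i < j)%N -> (n_ i < n_ j)%N)
    (n_enum : range n_ = [set n | same_trees N h n /\ (N <= n)%N]) :
  limn_esup (fun l : nat =>
    ((n_ l.+1)%:R - (n_ l)%:R - (h ord_max)%:R : R)%:E) = +oo%E.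
Proof.
apply: limn_esup_pinfty => A l0.
(* A gap longer than [L] still exceeds [A] after [h ord_max] is subtracted. *)
pose L := (Num.bound `|A| + h ord_max)%N.
(* Starting the run beyond [n_ l0] gives [n_ l0 <= x.-1], which forces the index of the gap to be at
   least [l0]. *)
have [x le_x many] :=
  run_with_many_primes (size (primes N)).+1 L (n_ l0).+1.
have [||l le_l gap] := @large_gap_around_run n_ x.-1 L l0 n_incr.
- by rewrite -ltnS (ltn_predK le_x).
- move=> l i ltiL; rewrite (ltn_predK le_x) => n_l.
  have [[_ tree_l _] _] : [set n | same_trees N h n /\ (N <= n)%N] (n_ l).
    by rewrite -n_enum; exists l.
  have := many i ltiL.
  by rewrite -n_l (size_primes_factor_tree _ _ tree_l) ltnn.
exists l => //; rewrite lee_fin lerBrDr -natrB; last exact/ltnW/n_incr.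
apply: (@le_trans _ _ L%:R); last by rewrite ler_nat ltnW.
rewrite natrD lerD2r; apply: le_trans (ler_norm A) _.
by rewrite ltW // archi_boundP.
Qed.
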